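(* Let $G=(V,E)$ be a connected graph on $n$ vertices with vertex set $V=\{v_1,\ldots,v_n\}$, let $d_{ij}=d_G(v_i,v_j)$ denote the distance between $v_i$ and $v_j$, and let $D_i=\sum_{j=1}^n d_{ij}$. Then $$q^{\mathcal{D}}(G)\leq \max_{1\leq i\leq n}\Bigg\{D_i+\sqrt{(n-1)\sum_{k=1}^n d_{ki}^2}\Bigg\}$$ and $$\mu^{\mathcal{D}}(G)\leq \max_{1\leq i\leq n}\Bigg\{D_i+\sqrt{(n-1)\sum_{k=1}^n d_{ki}^2}\Bigg\}.$$ Moreover, if equality holds in the first inequality (or in the second inequality), then $$D_i+\sqrt{(n-1)\sum_{k=1}^n d_{ki}^2}=D_j+\sqrt{(n-1)\sum_{k=1}^n d_{kj}^2}$$ for any $i,j\in\{1,2,\ldots,n\}$.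
   Context: Graphs are finite, simple and undirected. The distance $d_G(u,v)$ is the length of a shortest path connecting $u$ and $v$ in $G$. The distance matrix is $\mathcal{D}(G)=(d_{ij})$ with $d_{ij}=d_G(v_i,v_j)$; $D_i=\sum_{j=1}^n d_{ij}$ is the transmission (distance degree) of $v_i$, and $Tr(G)=\mathrm{diag}(D_1,\ldots,D_n)$. The distance Laplacian matrix is $\mathcal{L}(G)=Tr(G)-\mathcal{D}(G)$ and the distance signless Laplacian matrix is $\mathcal{Q}(G)=Tr(G)+\mathcal{D}(G)$. The distance Laplacian spectral radius $\mu^{\mathcal{D}}(G)$ and the distance signless Laplacian spectral radius $q^{\mathcal{D}}(G)$ are the spectral radii (largest modulus of an eigenvalue) of $\mathcal{L}(G)$ and $\mathcal{Q}(G)$, respectively. *)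

(* Defs.v *)
From HB Require Import structures.
From mathcomp Require Import all_boot all_order all_algebra.
From mathcomp Require Import complex.

Set Implicit Arguments.
Unset Strict Implicit.
Unset Printing Implicit Defensive.

Import Order.TTheory GRing.Theory Num.Theory.
Local Open Scope ring_scope.

(* A simple undirected graph on a finType T is given by its adjacency relation. *)
Definition simple_graph (T : finType) (e : rel T) : Prop :=
  symmetric e /\ irreflexive e.

Definition connected_graph (T : finType) (e : rel T) : Prop :=
  (0 < #|T|)%N /\ forall u v : T, connect e u v.

(* [p] lists the vertices after [u], so the length (number of edges) is k. *)
Definition has_path_of_length (T : finType) (e : rel T) (u v : T) (k : nat) :
    bool :=
  [exists p : k.-tuple T, [&& path e u p, uniq (u :: p) & last u p == v]].

(* The least length of a path. Every path has length < #|T|, so the search range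
   is sufficient; the value #|T| is only reached when u and v are not connected. *)
Definition gdist (T : finType) (e : rel T) (u v : T) : nat :=
  find (has_path_of_length e u v) (iota 0 #|T|).

Lemma gdistP (T : finType) (e : rel T) (u v : T) : connect e u v ->
  has_path_of_length e u v (gdist e u v) /\
  forall k : nat, has_path_of_length e u v k -> (gdist e u v <= k)%N.
Proof.
set P := has_path_of_length e u v => uv.
have lt_len k : P k -> (k < #|T|)%N.
  move=> /existsP[p /and3P[_ up _]].
  by have := max_card (mem (u :: p)); rewrite (card_uniqP up) /= size_tuple.
have hasP : has P (iota 0 #|T|).
  suff [k Pk] : exists k, P k.
    by apply/hasP; exists k => //; rewrite mem_iota /= add0n lt_len.
  case/connectP: uv => q0 q0p; case/shortenP: q0p => q qp qu _ vq.
  exists (size q); apply/existsP; exists (in_tuple q).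
  by apply/and3P; split=> //; rewrite vq.
have lt_d : (gdist e u v < #|T|)%N by move: hasP; rewrite has_find size_iota.
split; first by have := nth_find 0%N hasP; rewrite nth_iota.
move=> k Pk; rewrite leqNgt; apply/negP => ltk.
by have := before_find 0%N ltk; rewrite nth_iota ?lt_len // add0n -/P Pk.
Qed.

Section DistanceMatrices.
Variables (R : rcfType) (n : nat).
Implicit Type e : rel 'I_n.

Definition distance_matrix e : 'M[R]_n := \matrix_(i, j) (gdist e i j)%:R.

Definition transmission e (i : 'I_n) : R := \sum_j distance_matrix e i j.

Definition transmission_matrix e : 'M[R]_n := diag_mx (\row_i transmission e i).

Definition distance_laplacian e : 'M[R]_n :=
  transmission_matrix e - distance_matrix e.

Definition distance_signless_laplacian e : 'M[R]_n :=
  transmission_matrix e + distance_matrix e.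

(* The complex eigenvalues, listed with algebraic multiplicity. *)
Definition spectrum (M : 'M[R]_n) : seq R[i] :=
  sval (closed_field_poly_normal (char_poly (map_mx (real_complex R) M))).

Lemma mem_spectrum (M : 'M[R]_n) (z : R[i]) :
  (z \in spectrum M) = eigenvalue (map_mx (real_complex R) M) z.
Proof.
rewrite eigenvalue_root_char /spectrum; case: closed_field_poly_normal => r /= Dp.
by rewrite [in RHS]Dp (monicP (char_poly_monic _)) scale1r root_prod_XsubC.
Qed.

(* The spectrum is nonempty for n > 0 and moduli are nonnegative, so the
   default value 0 is harmless. *)
Definition spectral_radius (M : 'M[R]_n) : R :=
  \big[Num.max/0]_(z <- spectrum M) ComplexField.Normc.normc z.

Definition distance_laplacian_radius e : R :=
  spectral_radius (distance_laplacian e).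

Definition distance_signless_laplacian_radius e : R :=
  spectral_radius (distance_signless_laplacian e).

End DistanceMatrices.

(* Main.v *)
Require Import Defs.
From HB Require Import structures.
From mathcomp Require Import all_boot all_order all_algebra.
From mathcomp Require Import complex.
From mathcomp Require Import ring lra.

Set Implicit Arguments.
Unset Strict Implicit.
Unset Printing Implicit Defensive.

Import Order.TTheory GRing.Theory Num.Theory.
Local Open Scope ring_scope.

Import ComplexField.Normc.

(** Both matrices have nonnegative diagonal entries D_i and off-diagonal entries
    of modulus d_ki > 0, so the theorem is an instance of a bound for any real
    square matrix A with nonzero off-diagonal entries.

    Let z be an eigenvalue with row eigenvector v and put
    b_i = |A_ii| + sqrt ((n - 1) S_i), where S_i is the sum of A_ki^2 over
    k != i. The i-th coordinate of the eigenvector equation is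
    (z - A_ii) v_i = sum over k != i of v_k A_ki, and Cauchy-Schwarz gives
      (|z| - |A_ii|)^2 |v_i|^2 <= S_i (X - |v_i|^2),   X = sum of all |v_k|^2,
    as soon as |A_ii| <= |z|. Suppose that |z| >= b_i for every i. Then the left
    side is at least (n - 1) S_i |v_i|^2, and cancelling S_i > 0 leaves
    n |v_i|^2 <= X for every i. Summed over i these inequalities read
    n X <= n X, so each of them is an equality, all the |v_i| are equal and
    nonzero, and substituting back forces |z| = b_i for every i.

    This single rigidity statement (column_bound_eq) gives everything: a
    spectral radius that dominates all the b_i is equal to all of them. It
    therefore cannot exceed their maximum, and if it attains the maximum, the
    b_i coincide. *)

(** The Cauchy-Schwarz inequality: by Lagrange's identity, twice the difference
    of the two sides is the double sum of the squares
    (a_i b_j - a_j b_i)^2. *)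
Lemma sqr_sum_mul_le (R : realDomainType) (I : finType) (P : pred I)
    (a b : I -> R) :
  (\sum_(i | P i) a i * b i) ^+ 2
    <= (\sum_(i | P i) a i ^+ 2) * \sum_(i | P i) b i ^+ 2.
Proof.
have double_sum f g : (\sum_(i | P i) f i) * (\sum_(i | P i) g i)
    = \sum_(i | P i) \sum_(j | P j) f i * g j :> R.
  by rewrite mulr_suml; apply: eq_bigr => i _; rewrite mulr_sumr.
have lagrange : 0 <= \sum_(i | P i) \sum_(j | P j) (a i * b j - a j * b i) ^+ 2.
  by apply: sumr_ge0 => i _; apply: sumr_ge0 => j _; apply: sqr_ge0.
move: lagrange.
have -> : \sum_(i | P i) \sum_(j | P j) (a i * b j - a j * b i) ^+ 2
  = \sum_(i | P i) \sum_(j | P j) a i ^+ 2 * b j ^+ 2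
    + \sum_(i | P i) \sum_(j | P j) b i ^+ 2 * a j ^+ 2
    - 2 * \sum_(i | P i) \sum_(j | P j) (a i * b i) * (a j * b j).
  rewrite mulr_sumr -big_split /= -sumrB; apply: eq_bigr => i _.
  rewrite mulr_sumr -big_split /= -sumrB; apply: eq_bigr => j _; ring.
rewrite -!double_sum; nra.
Qed.

Lemma normc_ge0 (R : rcfType) (z : R[i]) : 0 <= normc z.
Proof. by case: z => a b; apply: sqrtr_ge0. Qed.

Lemma normc_real (R : rcfType) (a : R) : normc a%:C%C = `|a|.
Proof. by rewrite /= expr0n addr0 sqrtr_sqr. Qed.

(** The triangle inequality for the addition of [R[i]] itself, rather than that
    of the type alias that carries [normc] as its norm. *)
Lemma normc_triangle (R : rcfType) (x y : R[i]) :
  normc (x + y) <= normc x + normc y.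
Proof. exact: le_normcD. Qed.

Lemma normc_sum_le (R : rcfType) (I : finType) (P : pred I) (f : I -> R[i]) :
  normc (\sum_(i | P i) f i) <= \sum_(i | P i) normc (f i).
Proof.
apply: (big_ind2 (fun x y => normc x <= y)) => // [|x x' y y' hx hy].
  by rewrite normc0.
by apply: le_trans (normc_triangle _ _) _; apply: lerD.
Qed.

(** The rigidity argument, free of complex numbers: [y] stands for the squared
    moduli of the coordinates of an eigenvector, [t i] for the distance from the
    modulus of the eigenvalue to that of the diagonal entry. The two bounds on
    [t i ^+ 2] together say that [y i] is at most the mean of [y], and a family
    whose members are all at most its mean is constant. *)
Lemma sqr_gap_eq (R : realFieldType) (n : nat) (t y S : 'I_n -> R) :
  (forall i, 0 <= y i) -> (exists i, y i != 0) ->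
  (forall i k, k != i -> 0 < S i) ->
  (forall i, t i ^+ 2 * y i <= S i * \sum_(k | k != i) y k) ->
  (forall i, (n%:R - 1) * S i <= t i ^+ 2) ->
  forall i, t i ^+ 2 = (n%:R - 1) * S i.
Proof.
move=> y_ge0 [i0 yi0] S_gt0 t_le t_ge.
set X := \sum_k y k.
have X_split i : \sum_(k | k != i) y k = X - y i.
  by rewrite /X [in RHS](bigD1 i) //= [RHS]addrC addKr.
have ny_le i : n%:R * y i <= X.
  have [k ki|none] := pickP (fun k => k != i).
    rewrite -subr_ge0 -(pmulr_rge0 _ (S_gt0 i k ki)).
    have := t_le i; rewrite X_split.
    have := ler_wpM2r (y_ge0 i) (t_ge i); nra.
  (* No index other than i: here S i may vanish, but X = y i. *)
  have n1 : n = 1.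
    apply/eqP; rewrite -[n]card_ord; apply/eqP/(@eq_card1 _ i) => k.
    by have /negbFE := none k.
  by rewrite n1 mul1r -subr_ge0 -X_split sumr_ge0.
have ny_eq i : n%:R * y i = X.
  have gap0 : \sum_k (X - n%:R * y k) = 0.
    rewrite sumrB sumr_const card_ord -mulr_sumr -/X -[X *+ n]mulr_natl; ring.
  have gap_ge0 k : true -> 0 <= X - n%:R * y k by rewrite subr_ge0.
  have /eqP := psumr_eq0P gap_ge0 gap0 (i := i) isT.
  by rewrite subr_eq0 => /eqP/esym.
have n_neq0 : n%:R != 0 :> R by rewrite pnatr_eq0; case: {+}n i0 {yi0} => // -[].
have y_gt0 i : 0 < y i.
  rewrite lt0r y_ge0 andbT; apply: contra_neq yi0 => yi.
  by apply: (mulfI n_neq0); rewrite ny_eq -(ny_eq i) yi.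
move=> i; apply/eqP; rewrite eq_le t_ge andbT -(ler_pM2r (y_gt0 i)).
apply: le_trans (t_le i) _; rewrite X_split -(ny_eq i).
by rewrite le_eqVlt; apply/orP; left; apply/eqP; ring.
Qed.

Section MatrixBound.
Variables (R : rcfType) (n : nat).
Implicit Type A : 'M[R]_n.

(** For Tr(G) - D(G) and Tr(G) + D(G) this is the quantity
    D_i + sqrt ((n - 1) sum_k d_ki^2) of the theorem, since d_ii = 0. Columns
    are used because eigenvectors are row vectors. *)
Definition column_bound A (i : 'I_n) : R :=
  `|A i i| + Num.sqrt ((n%:R - 1) * \sum_(k | k != i) A k i ^+ 2).

Lemma column_bound_ge0 A i : 0 <= column_bound A i.
Proof. by rewrite addr_ge0 ?sqrtr_ge0. Qed.

(** Nonzero off-diagonal entries are essential: for the diagonal matrix with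
    entries 1 and 2, the eigenvalue 2 is at least both bounds, which differ. *)
Lemma column_bound_eq A (z : R[i]) :
  (forall i k, k != i -> A k i != 0) ->
  eigenvalue (map_mx (real_complex R) A) z ->
  (forall i, column_bound A i <= normc z) ->
  forall i, column_bound A i = normc z.
Proof.
move=> A_neq0 /eigenvalueP[v vA v_neq0] bz.
pose S i := \sum_(k | k != i) A k i ^+ 2.
pose t i := normc z - `|A i i|.
pose x i := normc (v 0 i).
have n_sub1_ge0 (i : 'I_n) : 0 <= n%:R - 1 :> R.
  by rewrite subr_ge0 ler1n; case: {+}n i => // -[].
have S_ge0 i : 0 <= S i by apply: sumr_ge0 => k _; apply: sqr_ge0.
have nS_ge0 i : 0 <= (n%:R - 1) * S i by rewrite mulr_ge0 ?n_sub1_ge0.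
have sqrt_le i : Num.sqrt ((n%:R - 1) * S i) <= t i.
  by rewrite /t lerBrDl; apply: bz.
have t_ge0 i : 0 <= t i by apply: le_trans (sqrt_le i); apply: sqrtr_ge0.
have t_eq : forall i, t i ^+ 2 = (n%:R - 1) * S i.
  apply: (@sqr_gap_eq _ _ _ (fun i => x i ^+ 2)) => [i||i k ki|i|i].
  - exact: sqr_ge0.
  - have /rV0Pn[i vi] := v_neq0; exists i; rewrite expf_eq0 /=.
    by apply: contra vi => /eqP/eq0_normc ->.
  - apply: lt_le_trans (_ : A k i ^+ 2 <= _).
      by rewrite exprn_even_gt0 //= A_neq0.
    by rewrite /S (bigD1 k) //= lerDl sumr_ge0 // => j _; apply: sqr_ge0.
  - have x_ge0 k : 0 <= x k by apply: normc_ge0.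
    have row_i : \sum_(k | k != i) v 0 k * (A k i)%:C%C
        = (z - (A i i)%:C%C) * v 0 i.
      have := congr1 (fun w : 'rV_n => w 0 i) vA.
      rewrite !mxE (bigD1 i) //= mxE mulrBl => <-.
      rewrite [_ * v 0 i]mulrC [RHS]addrC addKr.
      by apply: eq_bigr => k _; rewrite mxE.
    have term_eq k : normc (v 0 k * (A k i)%:C%C) = `|A k i| * x k.
      by rewrite normcM normc_real mulrC.
    have tx_le : t i * x i <= \sum_(k | k != i) `|A k i| * x k.
      rewrite -(eq_bigr _ (fun k _ => term_eq k)).
      apply: le_trans (normc_sum_le _ _); rewrite row_i normcM.
      rewrite ler_wpM2r // /t lerBlDr -(normc_real (A i i)).
      have := normc_triangle (z - (A i i)%:C%C) (A i i)%:C%C.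
      by rewrite subrK.
    have -> : S i = \sum_(k | k != i) `|A k i| ^+ 2.
      by apply: eq_bigr => k _; rewrite real_normK ?num_real.
    rewrite -exprMn; apply: le_trans (sqr_sum_mul_le _ _ _).
    rewrite ler_pXn2r ?nnegrE ?mulr_ge0 //.
    by apply: sumr_ge0 => k _; rewrite mulr_ge0.
  - rewrite -[leLHS]sqr_sqrtr // ler_pXn2r ?nnegrE ?sqrtr_ge0 //.
move=> i; rewrite /column_bound -/(S i) -t_eq sqrtr_sqr (ger0_norm (t_ge0 i)).
by rewrite /t addrC subrK.
Qed.
End MatrixBound.

(** The alternative 0 is the default value of the maximum over an empty
    spectrum. *)
Lemma spectral_radius_attained (R : rcfType) (n : nat) (A : 'M[R]_n) :
  spectral_radius A = 0 \/
  exists2 z, eigenvalue (map_mx (real_complex R) A) z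
    & normc z = spectral_radius A.
Proof.
rewrite /spectral_radius.
have : {in spectrum A, forall z, eigenvalue (map_mx (real_complex R) A) z}.
  by move=> z; rewrite mem_spectrum.
elim: (spectrum A) => [_|z s IH all_s]; first by left; rewrite big_nil.
rewrite big_cons; case: (leP (normc z)) => _.
  by apply: IH => w ws; apply: all_s; rewrite inE ws orbT.
by right; exists z => //; apply: all_s; rewrite inE eqxx.
Qed.

(** When the spectral radius is the default value 0, domination alone forces the
    nonnegative bounds to vanish; otherwise an eigenvalue attains it. *)
Lemma column_bound_spectral_radius (R : rcfType) (n : nat) (A : 'M[R]_n) :
  (forall i k, k != i -> A k i != 0) ->
  (forall i, column_bound A i <= spectral_radius A) ->
  forall i, column_bound A i = spectral_radius A.
Proof.
move=> A_neq0; case: (spectral_radius_attained A) => [->|[z Az <-]].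
  by move=> b_le i; apply/eqP; rewrite eq_le b_le column_bound_ge0.
exact: column_bound_eq.
Qed.

(** If the spectral radius exceeded B, it would dominate every column bound,
    hence be equal to each of them, and so be at most B. *)
Lemma spectral_radius_le_max (R : rcfType) (n : nat) (A : 'M[R]_n) :
  (0 < n)%N -> (forall i k, k != i -> A k i != 0) ->
  let B := \big[Num.max/0]_(i < n) column_bound A i in
  spectral_radius A <= B /\
  (spectral_radius A = B -> forall i, column_bound A i = B).
Proof.
move=> n_gt0 A_neq0 B.
have b_le i : column_bound A i <= B by apply: le_bigmax.
split=> [|radB i]; last first.
  by rewrite -radB; apply: column_bound_spectral_radius => // j; rewrite radB.
rewrite leNgt; apply/negP => B_lt; have := b_le (Ordinal n_gt0).
rewrite column_bound_spectral_radius // => [|j]; first by rewrite leNgt B_lt.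
by apply: le_trans (b_le j) (ltW B_lt).
Qed.

Lemma gdistxx (T : finType) (e : rel T) u : gdist e u u = 0%N.
Proof.
have [_ le_d] := gdistP (connect0 e u).
apply/eqP; rewrite -leqn0; apply: le_d.
by apply/existsP; exists [tuple]; rewrite /= eqxx.
Qed.

Lemma gdist_gt0 (T : finType) (e : rel T) u v :
  connect e u v -> u != v -> (0 < gdist e u v)%N.
Proof.
move=> /gdistP[+ _] uv; case: (gdist e u v) => // /existsP[p].
by rewrite (tuple0 p) /= (negbTE uv).
Qed.

Theorem theorem3p7 (R : rcfType) (n : nat) (e : rel 'I_n)
    (simple_e : simple_graph e) (connected_e : connected_graph e) :
  let d (i j : 'I_n) : R := (gdist e i j)%:R in
  let D (i : 'I_n) : R := \sum_(j < n) d i j in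
  let b (i : 'I_n) : R :=
    D i + Num.sqrt ((n%:R - 1) * \sum_(k < n) d k i ^+ 2) in
  let B : R := \big[Num.max/0]_(i < n) b i in
  [/\ distance_signless_laplacian_radius R e <= B,
      distance_laplacian_radius R e <= B
    & distance_signless_laplacian_radius R e = B \/
      distance_laplacian_radius R e = B ->
      forall i j : 'I_n, b i = b j].
Proof.
move=> d D b B; have [n_gt0 conn] := connected_e; rewrite card_ord in n_gt0.
have d_neq0 i k : k != i -> d k i != 0.
  by move=> ki; rewrite pnatr_eq0 -lt0n gdist_gt0.
have dii i : d i i = 0 by rewrite /d gdistxx.
have bound_eq (A : 'M[R]_n) :
    (forall i, A i i = D i) -> (forall i k, k != i -> `|A k i| = d k i) ->
    column_bound A =1 b.
  move=> Aii Aki i; rewrite /column_bound /b Aii ger0_norm ?sumr_ge0 //.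
  rewrite [in RHS](bigD1 i) //= dii expr0n add0r.
  congr (_ + Num.sqrt (_ * _)); apply: eq_bigr => k ki.
  by rewrite -(Aki i k ki) real_normK ?num_real.
have main (A : 'M[R]_n) :
    (forall i, A i i = D i) -> (forall i k, k != i -> `|A k i| = d k i) ->
    spectral_radius A <= B /\ (spectral_radius A = B -> forall i, b i = B).
  move=> Aii Aki; have bE := bound_eq A Aii Aki.
  have A_neq0 i k : k != i -> A k i != 0.
    by move=> ki; rewrite -normr_eq0 Aki ?d_neq0.
  have := spectral_radius_le_max n_gt0 A_neq0.
  rewrite /= (eq_bigr b) // -/B => -[-> eqB]; split=> // radB i.
  by rewrite -bE eqB.
have transE i : transmission R e i = D i.
  by apply: eq_bigr => j _; rewrite mxE.
have [Q_le Q_eq] : spectral_radius (distance_signless_laplacian R e) <= B /\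
    (spectral_radius (distance_signless_laplacian R e) = B -> forall i, b i = B).
  apply: main => [i|i k ki]; rewrite !mxE.
    by rewrite eqxx transE -/(d i i) dii addr0.
  by rewrite (negbTE ki) add0r normr_nat.
have [L_le L_eq] : spectral_radius (distance_laplacian R e) <= B /\
    (spectral_radius (distance_laplacian R e) = B -> forall i, b i = B).
  apply: main => [i|i k ki]; rewrite !mxE.
    by rewrite eqxx transE -/(d i i) dii subr0.
  by rewrite (negbTE ki) sub0r normrN normr_nat.
split=> // -[/Q_eq bB | /L_eq bB] i j; by rewrite !bB.
Qed.
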